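(* Let $A$ and $B$ be abelian groups. Then the map $$T:\mathrm{Hom}(A\otimes B,\mathbb{R}/\mathbb{Z})\oplus\mathrm{Quad}(A,\mathbb{R}/\mathbb{Z})\oplus\mathrm{Quad}(B,\mathbb{R}/\mathbb{Z})\to\mathrm{Quad}(A\oplus B,\mathbb{R}/\mathbb{Z}),$$ $$f\oplus\gamma_A\oplus\gamma_B\mapsto\big[(a,b)\mapsto f(a\otimes b)+\gamma_A(a)+\gamma_B(b)\big],$$ is a group isomorphism.
   Context: Tensor products are over $\mathbb{Z}$. For abelian groups $G,H$, a quadratic form from $G$ to $H$ is a function $\gamma:G\to H$ such that $\gamma(a)=\gamma(-a)$ and $\gamma(a+b+c)-\gamma(b+c)-\gamma(a+c)-\gamma(a+b)+\gamma(a)+\gamma(b)+\gamma(c)=0$ for all $a,b,c\in G$. $\mathrm{Quad}(G,H)$ is the group of all quadratic forms from $G$ to $H$ under pointwise addition. *)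

(* Defs.v *)
From HB Require Import structures.
From mathcomp Require Import all_boot all_order all_algebra.
From mathcomp Require Import boolp classical_sets functions reals.
From mathcomp.multinomials Require Import freeg.

Set Implicit Arguments.
Unset Strict Implicit.
Unset Printing Implicit Defensive.

Import GRing.Theory.

Local Open Scope ring_scope.
Local Open Scope quotient_scope.

Fact subrACA (V : zmodType) (x y z t : V) :
  (x - y) - (z - t) = (x - z) - (y - t).
Proof. by rewrite !opprD !opprK addrACA. Qed.

Section AbHom.
Variables G H : zmodType.

Definition is_hom : {pred (G -> H)} := fun f => `[< zmod_morphism f >].

Lemma is_hom_zmod_closed : zmod_closed is_hom.
Proof.
split=> [|f g /asboolP fB /asboolP gB]; apply/asboolP => x y.
  by rewrite /= subr0.
by rewrite !fctE fB gB subrACA.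
Qed.

HB.instance Definition _ :=
  GRing.isZmodClosed.Build (G -> H) is_hom is_hom_zmod_closed.

Record AbHom := MkAbHom { abhom_fun :> G -> H; _ : is_hom abhom_fun }.

HB.instance Definition _ := [isSub for abhom_fun].
HB.instance Definition _ := [Choice of AbHom by <:].
HB.instance Definition _ := [SubChoice_isSubZmodule of AbHom by <:].

End AbHom.

Section Quad.
Variables G H : zmodType.

Definition quadratic_form (q : G -> H) : Prop :=
  (forall a, q a = q (- a)) /\
  (forall a b c, q (a + b + c) - q (b + c) - q (a + c) - q (a + b)
                 + q a + q b + q c = 0).

Definition is_quad : {pred (G -> H)} := fun q => `[< quadratic_form q >].

Lemma is_quad_zmod_closed : zmod_closed is_quad.
Proof.
split=> [|f g /asboolP [fN fD] /asboolP [gN gD]]; apply/asboolP; split.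
- by [].
- by move=> a b c; rewrite /= !subr0 !addr0.
- by move=> a; rewrite !fctE fN gN.
- have sD (x y z t : H) : (x - y) + (z - t) = (x + z) - (y + t).
    by rewrite opprD addrACA.
  move=> a b c; rewrite !fctE (subrACA _ _ (f (b + c))).
  rewrite (subrACA _ _ (f (a + c))) (subrACA _ _ (f (a + b))).
  by rewrite 3!sD fD gD subrr.
Qed.

HB.instance Definition _ :=
  GRing.isZmodClosed.Build (G -> H) is_quad is_quad_zmod_closed.

Record Quad := MkQuad { quad_fun :> G -> H; _ : is_quad quad_fun }.

HB.instance Definition _ := [isSub for quad_fun].
HB.instance Definition _ := [Choice of Quad by <:].
HB.instance Definition _ := [SubChoice_isSubZmodule of Quad by <:].

End Quad.

Section GeneratedSubgroup.
Variables (V : zmodType) (S : set V).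

Definition zspan : {pred V} := fun x =>
  `[< forall P : {pred V}, zmod_closed P -> (forall y, S y -> y \in P) ->
      x \in P >].

Lemma zspan_zmod_closed : zmod_closed zspan.
Proof.
split=> [|x y /asboolP xS /asboolP yS]; apply/asboolP => P PB SP.
  by case: PB.
by case: (PB) => _; apply; [apply: xS|apply: yS].
Qed.

HB.instance Definition _ := GRing.isZmodClosed.Build V zspan zspan_zmod_closed.

End GeneratedSubgroup.

Section Tensor.
Variables A B : zmodType.

Definition tensor_relators : set {freeg (A * B)%type / int} :=
  [set x | (exists a a' b, x = << (a + a', b) >> - << (a, b) >> - << (a', b) >>)
        \/ (exists a b b', x = << (a, b + b') >> - << (a, b) >> - << (a, b') >>)].

(* The bilinear relations with integer scalars follow from biadditivity. *)
Definition tensor := Quotient.quot (zspan tensor_relators).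

HB.instance Definition _ := GRing.Zmodule.on tensor.

Definition tens (a : A) (b : B) : tensor := \pi << (a, b) >>.

End Tensor.

Section Circle.
Variable R : realType.

(* R / Z; Num.int_num_subdef is the predicate behind the qualifier Num.int. *)
Definition circle := Quotient.quot (@Num.int_num_subdef R : {pred R}).

HB.instance Definition _ := GRing.Zmodule.on circle.

End Circle.

(* Main.v *)
(** A function [q] is quadratic exactly when it is even and its polar form
    [q (x + y) - q x - q y] is biadditive.  Hence the polarization of a
    quadratic form on [A (+) B] between [(a, 0)] and [(0, b)] descends to
    [A (x) B], and subtracting it leaves the sum of the restrictions to the two
    factors. *)
Require Import Defs.
From HB Require Import structures.
From mathcomp Require Import all_boot all_order all_algebra.
From mathcomp Require Import boolp classical_sets functions reals.
From mathcomp.multinomials Require Import freeg.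

Set Implicit Arguments.
Unset Strict Implicit.
Unset Printing Implicit Defensive.

Import GRing.Theory.

Local Open Scope ring_scope.

Section QuadraticForms.
Variables G H : zmodType.
Implicit Types q : G -> H.

Definition polar q x y := q (x + y) - q x - q y.

(** For an arbitrary function [q], this turns the three-variable relation into additivity of
    [polar q] in its first argument, so each property can be traded for the other. *)
Lemma polar_defect q a b c :
  q (a + b + c) - q (b + c) - q (a + c) - q (a + b) + q a + q b + q c =
  polar q (a + b) c - (polar q a c + polar q b c).
Proof.
rewrite /polar.
move: (q (a + b + c)) (q (b + c)) (q (a + c)) (q (a + b)) (q a) (q b) (q c).
move=> qabc qbc qac qab qa qb qc; rewrite !opprD !opprK !addrA.
(* The right side has nine terms. The third and sixth, [- qc] and [qc], are grouped last and cancel;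
   the rest follow the order of the left side. *)
by rewrite [RHS](ACl (1*7*4*2*5*8*9*(3*6)))%AC /= addNr addr0.
Qed.

Lemma quadratic_form_polar q :
  (forall a, q a = q (- a)) ->
  (forall a b c, polar q (a + b) c = polar q a c + polar q b c) ->
  quadratic_form q.
Proof. by move=> qN qD; split=> // a b c; rewrite polar_defect qD subrr. Qed.

Lemma polarC q x y : polar q x y = polar q y x.
Proof. by rewrite /polar [x + y]addrC addrAC. Qed.

Variable q : G -> H.
Hypothesis q_quad : quadratic_form q.

Lemma polarDl a b c : polar q (a + b) c = polar q a c + polar q b c.
Proof.
by apply/eqP; rewrite -subr_eq0 -polar_defect; apply/eqP; case: q_quad.
Qed.

Lemma polarDr a b c : polar q a (b + c) = polar q a b + polar q a c.
Proof. by rewrite !(polarC _ a) polarDl. Qed.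

(** At [a = b = c = 0] the relation contains [q 0] with total coefficient 1 - 3 + 3 = 1. *)
Lemma quadratic_form0 : q 0 = 0.
Proof.
case: q_quad => _ /(_ 0 0 0).
by rewrite !addr0 subrr sub0r addrNK addNr add0r.
Qed.

Lemma quadratic_form_comp (K : zmodType) (h : K -> G) :
  zmod_morphism h -> quadratic_form (q \o h).
Proof.
move=> hB; pose hL := GRing.isZmodMorphism.Build K G h hB.
pose h' : {additive K -> G} := HB.pack h hL.
have hN : {morph h : x / - x} := raddfN h'.
have hD : {morph h : x y / x + y} := raddfD h'.
by case: q_quad => qN qD; split=> [a|a b c] /=; rewrite ?hN ?hD.
Qed.

End QuadraticForms.

Definition biadditive (A B H : zmodType) (s : A -> B -> H) :=
  (forall a a' b, s (a + a') b = s a b + s a' b) /\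
  (forall a b b', s a (b + b') = s a b + s a b').

Section Biadditive.
Variables (A B H : zmodType) (s : A -> B -> H).
Hypothesis s_biadd : biadditive s.

Lemma biadditive0l b : s 0 b = 0.
Proof.
by apply: (@addrI _ (s 0 b)); case: s_biadd => sDl _; rewrite -sDl !addr0.
Qed.

Lemma biadditive0r a : s a 0 = 0.
Proof.
by apply: (@addrI _ (s a 0)); case: s_biadd => _ sDr; rewrite -sDr !addr0.
Qed.

Lemma biadditiveNN a b : s (- a) (- b) = s a b.
Proof.
have [sDl sDr] := s_biadd.
have sNl : s (- a) (- b) = - s a (- b).
  by apply/eqP; rewrite -addr_eq0 -sDl addNr biadditive0l.
by apply/eqP; rewrite sNl eqr_oppLR -addr_eq0 -sDr addNr biadditive0r.
Qed.

Lemma quadratic_form_biadditive :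
  quadratic_form (fun x : A * B => s x.1 x.2).
Proof.
have [sDl sDr] := s_biadd.
apply: quadratic_form_polar => [x|x y z].
  by rewrite /= biadditiveNN.
(* The diagonal terms [s u.1 u.2] and [s v.1 v.2] cancel, and each remaining mixed term is additive
   in [u]. *)
have polarE u v :
    polar (fun x : A * B => s x.1 x.2) u v = s u.1 v.2 + s v.1 u.2.
  rewrite /polar /= sDl !sDr.
  move: (s _ _) (s _ _) (s _ _) (s _ _) => p q r t; rewrite !addrA.
  by rewrite [LHS](ACl (2*3*(1*5)*(4*6)))%AC /= !subrr !addr0.
by rewrite !polarE /= sDl sDr addrACA.
Qed.

End Biadditive.

Section TensorProduct.
Local Open Scope quotient_scope.
Variables A B H : zmodType.

Lemma pi_tensorB x y :
  \pi_(tensor A B) (x - y) = \pi_(tensor A B) x - \pi_(tensor A B) y.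
Proof. exact: pi_is_zmod_morphism. Qed.

Lemma tens_biadditive : biadditive (@tens A B).
Proof.
(* Every relator has the shape [x - y - z], so its vanishing in the quotient is an additivity
   equation. *)
have relE (x y z : {freeg (A * B)%type / int}) :
    tensor_relators (x - y - z) ->
    \pi_(tensor A B) x = \pi_(tensor A B) y + \pi_(tensor A B) z.
  move=> rel; apply/eqP; rewrite -subr_eq0 opprD addrA -!pi_tensorB.
  rewrite -[0](raddf0 \pi_(tensor A B)) -Quotient.idealrBE subr0.
  by apply/asboolP => P _; apply.
split=> [a a' b|a b b']; apply: relE.
  by left; exists a, a', b.
by right; exists a, b, b'.
Qed.

(** Defined for any [s] through a chosen representative; independence of the choice is proved below
    for biadditive [s]. The type [zmodule H] views [H] as a module over the integers, as [fglift]
    expects. *)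
Definition tensor_lift (s : A -> B -> H) (t : tensor A B) : H :=
  fglift (fun x => s x.1 x.2 : zmodule H) (repr t).

Section Lift.
Variable s : A -> B -> H.
Hypothesis s_biadd : biadditive s.

Let s' (x : A * B) : zmodule H := s x.1 x.2.

(** The kernel of [fglift s'] is a subgroup, and it contains the relators because [s] is biadditive;
    hence it contains the subgroup they generate. *)
Lemma fglift_zspan x : x \in zspan (@tensor_relators A B) -> fglift s' x = 0.
Proof.
have [sDl sDr] := s_biadd.
have L := lift_is_additive s'.
move=> /asboolP /(_ [pred x | fglift s' x == 0]) H0; apply/eqP/H0.
  split; first by rewrite inE -(subrr 0) L subrr.
  by move=> u v; rewrite !inE L => /eqP-> /eqP->; rewrite subrr.
move=> y [] [a [b [c ->]]]; rewrite inE !L !liftU !scale1r /s' /=.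
  by rewrite sDl addrAC addrK subrr.
by rewrite sDr addrAC addrK subrr.
Qed.

Lemma tensor_lift_pi x : tensor_lift s (\pi x) = fglift s' x.
Proof.
apply/eqP; rewrite -subr_eq0 /tensor_lift -(lift_is_additive s').
by apply/eqP/fglift_zspan; rewrite Quotient.idealrBE reprK.
Qed.

Lemma tensor_lift_tens a b : tensor_lift s (tens a b) = s a b.
Proof. by rewrite tensor_lift_pi liftU scale1r. Qed.

Lemma tensor_lift_is_hom : is_hom (tensor_lift s).
Proof.
apply/asboolP => x y; rewrite -[x]reprK -[y]reprK -pi_tensorB !tensor_lift_pi.
exact: (lift_is_additive s').
Qed.

End Lift.

HB.instance Definition _ (f : AbHom (tensor A B) H) :=
  GRing.isZmodMorphism.Build _ _ (f : tensor A B -> H) (asboolW (valP f)).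

(** A representative is an integer combination of generators [<< (a, b) >>], whose classes are the
    pure tensors, so additivity determines the value. *)
Lemma abhom_tensor_ext (f g : AbHom (tensor A B) H) :
  (forall a b, f (tens a b) = g (tens a b)) -> f = g.
Proof.
move=> fg; apply/val_inj/funext => t /=.
rewrite -[t]reprK -[repr t]freeg_sumE !raddf_sum.
apply: eq_bigr => -[a b] _ /=; rewrite -[coeff _ _]intz -freegU_mulz.
by rewrite !raddfMz; congr (_ *~ _); exact: fg.
Qed.

Lemma abhom_tens_biadditive (f : AbHom (tensor A B) H) :
  biadditive (fun a b => f (tens a b)).
Proof.
by have [tDl tDr] := tens_biadditive; split=> *; rewrite (tDl, tDr) raddfD.
Qed.

End TensorProduct.

Section QuadOfSum.
Variables A B H : zmodType.

Local Notation components := (AbHom (tensor A B) H * Quad A H * Quad B H)%type.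

Lemma quadP (G : zmodType) (q : Quad G H) : quadratic_form q.
Proof. exact: asboolW (valP q). Qed.

Definition sum_quad_fun (x : components) (p : A * B) : H :=
  x.1.1 (tens p.1 p.2) + x.1.2 p.1 + x.2 p.2.

Lemma sum_quad_subproof x : is_quad (sum_quad_fun x).
Proof.
(* Written as a pointwise sum, the function is covered by closure of [is_quad] under addition, and
   each summand is treated separately. *)
suff: (fun p : A * B => x.1.1 (tens p.1 p.2)) + (x.1.2 \o fst) + (x.2 \o snd)
      \in @is_quad (A * B)%type H by [].
rewrite !rpredD //; apply/asboolP.
- exact: quadratic_form_biadditive (abhom_tens_biadditive x.1.1).
- exact: (quadratic_form_comp (quadP x.1.2)).
- exact: (quadratic_form_comp (quadP x.2)).
Qed.

Definition sum_quad x := MkQuad (sum_quad_subproof x).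

Lemma sum_quad_is_additive : zmod_morphism sum_quad.
Proof.
move=> x y; apply/val_inj/funext => p /=.
rewrite /sum_quad_fun /= !fctE /=.
by rewrite opprD [RHS]addrACA opprD [X in _ = X + _]addrACA.
Qed.

HB.instance Definition _ :=
  GRing.isZmodMorphism.Build components (Quad (A * B)%type H) sum_quad
    sum_quad_is_additive.

Lemma inl_is_additive : zmod_morphism (fun a => (a, 0) : A * B).
Proof. by move=> a a'; congr (_, _); rewrite subr0. Qed.

Lemma inr_is_additive : zmod_morphism (fun b => (0, b) : A * B).
Proof. by move=> b b'; congr (_, _); rewrite subr0. Qed.

Variable q : Quad (A * B)%type H.

Definition cross (a : A) (b : B) : H := polar q (a, 0) (0, b).

Lemma cross_biadditive : biadditive cross.
Proof.
split=> [a a' b|a b b']; rewrite /cross.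
  by rewrite -(polarDl (quadP q)); congr polar; congr (_, _); rewrite addr0.
by rewrite -(polarDr (quadP q)); congr polar; congr (_, _); rewrite addr0.
Qed.

Lemma crossE a b : cross a b = q (a, b) - q (a, 0) - q (0, b).
Proof. by congr (q (_, _) - _ - _); rewrite (addr0, add0r). Qed.

(** The inverse of [sum_quad]: the polarization between the two factors gives the tensor component,
    and the restrictions to the factors give the other two. *)
Definition quad_components : components :=
  (MkAbHom (tensor_lift_is_hom cross_biadditive),
   MkQuad (asboolT (quadratic_form_comp (quadP q) inl_is_additive)),
   MkQuad (asboolT (quadratic_form_comp (quadP q) inr_is_additive))).

End QuadOfSum.

(** Since [f] kills [tens a 0] and [tens 0 b], and [gA], [gB] vanish at 0, restriction to a factor
    isolates [gA] or [gB], and the cross term isolates [f]. *)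
Lemma sum_quadK A B H : cancel (@sum_quad A B H) (@quad_components A B H).
Proof.
move=> [[f gA] gB]; have [f0l f0r] := (biadditive0l (abhom_tens_biadditive f),
                                       biadditive0r (abhom_tens_biadditive f)).
have [gA0 gB0] := (quadratic_form0 (quadP gA), quadratic_form0 (quadP gB)).
congr (_, _, _).
- apply: abhom_tensor_ext => a b /=.
  rewrite tensor_lift_tens; last exact: cross_biadditive.
  rewrite crossE /= /sum_quad_fun /= f0l f0r gA0 gB0.
  by rewrite !(add0r, addr0) addrAC !addrK.
- by apply/val_inj/funext => a; rewrite /= /sum_quad_fun /= f0r gB0 add0r addr0.
- by apply/val_inj/funext => b; rewrite /= /sum_quad_fun /= f0l gA0 !add0r.
Qed.

Lemma quad_componentsK A B H :
  cancel (@quad_components A B H) (@sum_quad A B H).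
Proof.
move=> q; apply/val_inj/funext => -[a b]; rewrite /= /sum_quad_fun /=.
rewrite tensor_lift_tens; last exact: cross_biadditive.
(* The two values subtracted in [cross] are exactly the restrictions added back. *)
by rewrite crossE addrAC subrK subrK.
Qed.

Theorem proposition4p3 (R : realType) (A B : zmodType) :
  exists T : {additive (AbHom (tensor A B) (circle R) *
                        Quad A (circle R) * Quad B (circle R))%type
                       -> Quad (A * B)%type (circle R)},
    (forall (f : AbHom (tensor A B) (circle R))
            (gA : Quad A (circle R)) (gB : Quad B (circle R)) (a : A) (b : B),
        T (f, gA, gB) (a, b) = f (tens a b) + gA a + gB b)
    /\ bijective T.
Proof.
exists (@sum_quad A B (circle R)); split=> //.
exact: Bijective (@sum_quadK A B (circle R)) (@quad_componentsK A B (circle R)).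
Qed.
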